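(* Let $V\subset\mathbb R[\mathbf x]$ be a vector space connected to $1$, and let $\sigma$ be a linear form on $\langle V\cdot V\rangle$. Let $U\subset V$ be a subspace with $1\in U$ and $U^+\subset V$. Suppose that $\operatorname{rank}H^{V,V}_\sigma=\operatorname{rank}H^{U,U}_\sigma=r$ and that $\langle\sigma\mid p^2\rangle\ge0$ for all $p\in V$. Then there is a unique $\tilde\sigma\in\mathbb R[[\mathbf y]]$ which coincides with $\sigma$ on $\langle V\cdot V\rangle$ and satisfies $\operatorname{rank}H_{\tilde\sigma}=r$. It is of the form $$\tilde\sigma=\sum_{i=1}^r\omega_i\,\mathbf e_{\xi_i}(\mathbf y)$$ with $\omega_i>0$ and $\xi_i\in\mathbb R^n$.
   Context: $\mathbb R[[\mathbf y]]$ is identified with the dual of $\mathbb R[\mathbf x]$ via $\langle\mathbf y^\alpha\mid\mathbf x^\beta\rangle=\alpha!\,\delta_{\alpha\beta}$. $H_\sigma:p\mapsto p\star\sigma$ with $\langle p\star\sigma\mid q\rangle=\langle\sigma\mid pq\rangle$. $\mathbf e_\xi(\mathbf y)=\exp(\sum_j\xi_jy_j)$. $V^+=V+x_1V+\dots+x_nV$. The space $V$ is connected to $1$ if there is a finite chain $\langle1\rangle=V_0\subset V_1\subset\dots\subset V_s=V$ with $V_{l+1}\subset V_l^+$. $\langle V\cdot V\rangle$ is the span of the products of pairs of elements of $V$. For $W\subset V$, $H^{W,W}_\sigma:W\to W^*$ is $p\mapsto(w\mapsto\langle\sigma\mid pw\rangle)$. *)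

(* Defs.v *)
From HB Require Import structures.
From mathcomp Require Import all_boot all_order all_algebra.
Set Implicit Arguments. Unset Strict Implicit. Unset Printing Implicit Defensive.
Import Order.TTheory GRing.Theory Num.Theory.
Local Open Scope ring_scope.

(* R[x_1,...,x_n] as iterated univariate polynomials:
   mpoly R 0 = R, mpoly R (n+1) = (mpoly R n)[x_1]  (x_1 outermost). *)
Fixpoint mpoly (R : comNzRingType) (n : nat) : comNzRingType :=
  if n is n'.+1 then ({poly mpoly R n'} : comNzRingType) else R.

Section MDefs.
Variable R : fieldType.

Fixpoint mC (n : nat) : R -> mpoly R n :=
  match n return R -> mpoly R n with
  | 0 => fun a => a
  | n'.+1 => fun a => ((mC n' a)%:P : {poly mpoly R n'})
  end.

Fixpoint mX (n : nat) : 'I_n -> mpoly R n :=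
  match n return 'I_n -> mpoly R n with
  | 0 => fun i => mC 0 0
  | n'.+1 => fun i =>
      match unlift ord0 i with
      | None => ('X : {poly mpoly R n'})
      | Some j => ((mX j)%:P : {poly mpoly R n'})
      end
  end.

Definition mmono (n : nat) (a : n.-tuple nat) : mpoly R n :=
  \prod_(i < n) mX i ^+ tnth a i.

Definition mfact (n : nat) (a : n.-tuple nat) : R :=
  (\prod_(i < n) (tnth a i)`!)%:R.

(* Formal power series R[[y]]: the coefficient of y^alpha. *)
Definition series (n : nat) := n.-tuple nat -> R.

(* The duality <y^alpha | x^beta> = alpha! delta_{alpha beta}, i.e.
   <s | p> = sum_alpha s_alpha * alpha! * p_alpha. *)
Fixpoint mpair (n : nat) : series n -> mpoly R n -> R :=
  match n return series n -> mpoly R n -> R with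
  | 0 => fun s p => s [tuple] * p
  | n'.+1 => fun s (p : {poly mpoly R n'}) =>
      \sum_(k < size p) mpair (fun b : n'.-tuple nat => s (cons_tuple (k : nat) b) * (k`!)%:R) p`_k
  end.

(* p * s  (p star sigma): <p * s | q> = <s | p q>; its coefficient of y^alpha
   is <s | p x^alpha> / alpha!. *)
Definition mstar (n : nat) (s : series n) (p : mpoly R n) : series n :=
  fun a => mpair s (p * mmono a) / mfact a.

(* e_xi(y) = exp(sum_j xi_j y_j) = sum_alpha xi^alpha / alpha! y^alpha *)
Definition expser (n : nat) (xi : 'I_n -> R) : series n :=
  fun a => \prod_(i < n) (xi i ^+ tnth a i / ((tnth a i)`!)%:R).

Definition subspace (n : nat) (V : mpoly R n -> Prop) : Prop :=
  V 0 /\ forall (c : R) p q, V p -> V q -> V (mC n c * p + q).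

Definition vplus (n : nat) (V : mpoly R n -> Prop) : mpoly R n -> Prop :=
  fun p => exists (q0 : mpoly R n) (qs : 'I_n -> mpoly R n),
    V q0 /\ (forall i, V (qs i)) /\ p = q0 + \sum_(i < n) mX i * qs i.

Definition span1 (n : nat) : mpoly R n -> Prop := fun p => exists c : R, p = mC n c.

Definition connected_to_1 (n : nat) (V : mpoly R n -> Prop) : Prop :=
  exists (s : nat) (W : nat -> mpoly R n -> Prop),
    (forall l, subspace (W l)) /\
    (forall p, W 0%N p <-> span1 p) /\
    (forall l, (l < s)%N ->
       (forall p, W l p -> W l.+1 p) /\ (forall p, W l.+1 p -> vplus (W l) p)) /\
    (forall p, W s p <-> V p).

Definition prodspan (n : nat) (V : mpoly R n -> Prop) : mpoly R n -> Prop :=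
  fun p => exists (k : nat) (a b : 'I_k -> mpoly R n),
    (forall i, V (a i) /\ V (b i)) /\ p = \sum_(i < k) a i * b i.

Definition linear_on (n : nat) (W : mpoly R n -> Prop) (sigma : mpoly R n -> R) :=
  forall (c : R) p q, W p -> W q -> sigma (mC n c * p + q) = c * sigma p + sigma q.

(* A linear map p |-> f p, from the subspace D to functionals on T
   (functionals compared on T), has rank r: its image has dimension r. *)
Definition has_rank (X Y : Type) (D : X -> Prop) (T : Y -> Prop)
    (f : X -> Y -> R) (r : nat) : Prop :=
  exists ps : 'I_r -> X,
    (forall i, D (ps i)) /\
    (forall c : 'I_r -> R,
       (forall y, T y -> \sum_(i < r) c i * f (ps i) y = 0) -> forall i, c i = 0) /\
    (forall p, D p -> exists c : 'I_r -> R,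
       forall y, T y -> f p y = \sum_(i < r) c i * f (ps i) y).

Definition hankel_rank (n : nat) (s : series n) (r : nat) : Prop :=
  has_rank (fun _ : mpoly R n => True) (fun _ : n.-tuple nat => True)
    (fun p a => mstar s p a) r.

Definition sub_hankel_rank (n : nat) (sigma : mpoly R n -> R)
    (W : mpoly R n -> Prop) (r : nat) : Prop :=
  has_rank W W (fun p w => sigma (p * w)) r.

End MDefs.

(* Main.v *)
Require Import Defs.
From HB Require Import structures.
From mathcomp Require Import all_boot all_order all_algebra.
From mathcomp Require Import complex ring lra.
From Stdlib Require Import FunctionalExtensionality.
Set Implicit Arguments. Unset Strict Implicit. Unset Printing Implicit Defensive.
Import Order.TTheory GRing.Theory Num.Theory.
Local Open Scope ring_scope.

(* Take b_1, ..., b_r in U whose functionals form a basis of the image of H^{U,U}.  By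
   equality of the ranks they also span modulo ker H^{V,V}, the Gram matrix
   G = (sigma(b_k b_l)) is positive definite, and since x_i U is contained in V,
   multiplication by x_i induces a matrix M_i on V / ker H^{V,V}.  The M_i commute
   and are self-adjoint for G, hence are simultaneously diagonalizable over R:
   P M_i = D_i P.  Connectedness of V to 1 shows that the k-th coordinate of the
   class of v in the eigenbasis is v(xi_k) a_k, where xi_k lists the k-th diagonal
   entries of the D_i and a_k are the coordinates of 1.  As these classes span, a_k is
   nonzero and the xi_k are distinct, so the eigenbasis is G-orthogonal and
   sigma(v w) = sum_k delta_k a_k^2 v(xi_k) w(xi_k) with delta_k > 0.
   Conversely, an extension s of rank r satisfies the recursion
   s(b_k x_i p) = sum_l (M_i)_kl s(b_l p), which determines it. *)

(** * Polynomials and their pairing with series *)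

Section Polynomials.
Variable R : fieldType.

Lemma mC1 n : mC n 1 = 1 :> mpoly R n.
Proof. by elim: n => [|n IHn] //=; rewrite IHn. Qed.

Lemma mX0 n : mX R (ord0 : 'I_n.+1) = ('X : {poly mpoly R n}).
Proof. by rewrite /= unlift_none. Qed.

Lemma mX_lift n (i : 'I_n) : mX R (lift ord0 i) = (mX R i)%:P :> {poly mpoly R n}.
Proof. by rewrite /= liftK. Qed.

(** By induction on the number of variables, [P] holds for all polynomials that are constant in the
    outermost variable; Horner's scheme then reaches the others. *)
Lemma mpoly_ind n (P : mpoly R n -> Prop) :
  (forall c, P (mC n c)) -> (forall p q, P p -> P q -> P (p + q)) ->
  (forall i p, P p -> P (mX R i * p)) -> forall p, P p.
Proof.
elim: n P => [|n IHn] P PC PD PX p; first exact: PC.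
have Pconst (c : mpoly R n) : P (c%:P : {poly mpoly R n}).
  apply: (IHn (fun c => P (c%:P : {poly mpoly R n}))) => [a|q1 q2|i q].
  - exact: PC.
  - by rewrite polyCD; apply: PD.
  - by rewrite polyCM -mX_lift; apply: PX.
elim/poly_ind: p => [|q c Pq]; first by rewrite -polyC0.
by apply: (PD _ _ _ (Pconst c)); rewrite mulrC -mX0; apply: PX.
Qed.

Lemma eq_mpair n (s t : series R n) p :
  (forall a, s a = t a) -> mpair s p = mpair t p.
Proof.
elim: n s t p => [|n IHn] s t p eq_st /=; first by rewrite eq_st.
by apply: eq_bigr => k _; apply: IHn => b; rewrite eq_st.
Qed.

Lemma mpair0 n (s : series R n) : mpair s 0 = 0.
Proof. by case: n s => [|n] s /=; rewrite ?mulr0 // size_poly0 big_ord0. Qed.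

(** Allows polynomials of different sizes to be paired over one common range. *)
Lemma mpair_widen n (s : series R n.+1) (p : {poly mpoly R n}) N :
  (size p <= N)%N ->
  mpair s p =
  \sum_(k < N) mpair (fun b : n.-tuple nat => s (cons_tuple (k : nat) b) * (k`!)%:R) p`_k.
Proof.
move=> szp /=; rewrite (big_ord_widen N (fun k : nat =>
  mpair (fun b : n.-tuple nat => s (cons_tuple k b) * (k`!)%:R) p`_k)) //.
rewrite big_mkcond; apply: eq_bigr => k _; case: ltnP => // szk.
by rewrite nth_default // mpair0.
Qed.

Lemma mpair_linear n (s : series R n) c p q :
  mpair s (mC n c * p + q) = c * mpair s p + mpair s q.
Proof.
elim: n s p q => [|n IHn] s p q; first by rewrite /= mulrDr mulrCA.
pose N := maxn (size (mC n.+1 c * p + q : {poly mpoly R n}))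
            (maxn (size (p : {poly mpoly R n})) (size (q : {poly mpoly R n}))).
rewrite !(@mpair_widen _ _ _ N) ?leq_max ?leqnn ?orbT // mulr_sumr -big_split.
by apply: eq_bigr => k _; rewrite /= coefD coefCM IHn.
Qed.

Lemma mpairD n (s : series R n) : {morph mpair s : p q / p + q}.
Proof. by move=> p q; have := mpair_linear s 1 p q; rewrite mC1 !mul1r. Qed.

Lemma mpairZ n (s : series R n) c p : mpair s (mC n c * p) = c * mpair s p.
Proof. by have := mpair_linear s c p 0; rewrite mpair0 !addr0. Qed.

Lemma mpair_sum n (s : series R n) (I : Type) (l : seq I) (f : I -> mpoly R n) :
  mpair s (\sum_(i <- l) f i) = \sum_(i <- l) mpair s (f i).
Proof. exact: (big_morph _ (mpairD s) (mpair0 s)). Qed.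

Lemma mpair_series_linear n (I : Type) (l : seq I) (c : I -> R)
    (s : I -> series R n) p :
  mpair (fun a => \sum_(i <- l) c i * s i a) p = \sum_(i <- l) c i * mpair (s i) p.
Proof.
elim: n s p => [|n IHn] s p /=.
  by rewrite mulr_suml; apply: eq_bigr => i _; rewrite mulrA.
transitivity (\sum_(k < size (p : {poly mpoly R n})) \sum_(i <- l) c i *
   mpair (fun b : n.-tuple nat => s i (cons_tuple (k : nat) b) * (k`!)%:R)
     (p : {poly mpoly R n})`_k).
  apply: eq_bigr => k _; rewrite -IHn; apply: eq_mpair => b.
  by rewrite mulr_suml; apply: eq_bigr => i _; rewrite mulrA.
by rewrite exchange_big; apply: eq_bigr => i _; rewrite mulr_sumr.
Qed.

Lemma mpair_seriesZ n c (s : series R n) p :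
  mpair (fun a => c * s a) p = c * mpair s p.
Proof.
have := mpair_series_linear [:: tt] (fun=> c) (fun=> s) p.
by rewrite big_seq1 => <-; apply: eq_mpair => a; rewrite big_seq1.
Qed.

Lemma tnth_lift0 n (a : n.+1.-tuple nat) i :
  tnth a (lift ord0 i) = tnth (behead_tuple a) i.
Proof. by rewrite !(tnth_nth 0%N) /= nth_behead. Qed.

Lemma mmono_cons n (a : n.+1.-tuple nat) :
  mmono R a = (mmono R (behead_tuple a))%:P * 'X^(thead a) :> {poly mpoly R n}.
Proof.
rewrite /mmono big_ord_recl mulrC mX0; congr (_ * _).
rewrite rmorph_prod; apply: eq_bigr => i _.
by rewrite mX_lift rmorphXn tnth_lift0.
Qed.

Lemma mpair_mmono n (s : series R n) a : mpair s (mmono R a) = s a * mfact R a.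
Proof.
elim: n s a => [|n IHn] s a.
  by rewrite [a]tuple0 /mmono /mfact !big_ord0.
rewrite mmono_cons (@mpair_widen _ _ _ (thead a).+1); last first.
  apply: leq_trans (size_polyMleq _ _) _; rewrite size_polyXn addnS /=.
  by apply: leq_trans (leq_add (size_polyC_leq1 _) (leqnn _)) _.
rewrite (bigD1 ord_max) //= big1 ?addr0 => [|k /negPf]; last first.
  rewrite -val_eqE /= => neq_k.
  by rewrite coefCM coefXn neq_k mulr0 mpair0.
rewrite coefCM coefXn eqxx mulr1 IHn /mfact big_ord_recl natrM mulrA.
congr (s _ * _ * _); first by rewrite [RHS]tuple_eta.
by congr (_%:R); apply: eq_bigr => i _; rewrite tnth_lift0.
Qed.

Lemma mX_mmono n (i : 'I_n) (a : n.-tuple nat) :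
  mX R i * mmono R a = mmono R [tuple (tnth a j + (j == i))%N | j < n].
Proof.
rewrite /mmono (bigD1 i) //= [RHS](bigD1 i) //= tnth_mktuple eqxx addn1 exprS.
rewrite -!mulrA; congr (_ * (_ * _)); apply: eq_bigr => j /negPf neq_ji.
by rewrite tnth_mktuple neq_ji addn0.
Qed.

Lemma mpoly_ind_mmono n (P : mpoly R n -> Prop) :
  (forall c a, P (mC n c * mmono R a)) ->
  (forall p q, P p -> P q -> P (p + q)) -> forall p, P p.
Proof.
move=> Pm PD p; have mono0 : mmono R [tuple 0 | j < n]%N = 1.
  by rewrite /mmono big1 // => j _; rewrite tnth_mktuple expr0.
(* Generalize from p to p x^a for all a, so that a factor x_i is absorbed by shifting a. *)
rewrite -[p]mulr1 -mono0.
elim/mpoly_ind: p [tuple _ | j < n] => {mono0} [c|p q Pp Pq|i p Pp] a.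
- exact: Pm.
- by rewrite mulrDl; apply: PD.
- by rewrite mulrAC mulrC mX_mmono; apply: Pp.
Qed.

End Polynomials.

(* Since <e_xi | p> = p(xi), mpair (expser xi) serves as evaluation at xi. *)
Section Evaluation.
Variable R : numFieldType.

Lemma factf_neq0 k : (k`!)%:R != 0 :> R.
Proof. by rewrite pnatr_eq0 -lt0n fact_gt0. Qed.

Lemma mfact_neq0 n (a : n.-tuple nat) : mfact R a != 0.
Proof.
by rewrite /mfact natr_prod; apply/prodf_neq0 => i _; apply: factf_neq0.
Qed.

Lemma mpair_inj n (s t : series R n) :
  (forall p, mpair s p = mpair t p) -> forall a, s a = t a.
Proof.
by move=> eq_st a; apply: (mulIf (mfact_neq0 a)); rewrite -!mpair_mmono.
Qed.

(** The factor k! of the pairing cancels the denominator in [expser], which leaves the exponential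
    series in the remaining variables. *)
Lemma mpair_expser_cons n (xi : 'I_n.+1 -> R) (p : {poly mpoly R n}) N :
  (size p <= N)%N -> mpair (expser xi) p =
  \sum_(k < N) xi ord0 ^+ k * mpair (expser (fun i => xi (lift ord0 i))) p`_k.
Proof.
move=> szp; rewrite (mpair_widen _ szp); apply: eq_bigr => k _.
rewrite -mpair_seriesZ; apply: eq_mpair => b.
rewrite /expser big_ord_recl {1 2}/tnth /= mulrAC divfK ?factf_neq0 //.
congr (_ * _); apply: eq_bigr => i _.
by rewrite (tnth_nth 0%N) [tnth _ i](tnth_nth 0%N).
Qed.

Lemma mpair_expserC n (xi : 'I_n -> R) c : mpair (expser xi) (mC n c) = c.
Proof.
elim: n xi => [|n IHn] xi; first by rewrite /= /expser big_ord0 mul1r.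
rewrite (@mpair_expser_cons _ _ _ 1) ?size_polyC_leq1 //.
by rewrite big_ord1 mul1r /= coefC IHn.
Qed.

Lemma mpair_expserX n (xi : 'I_n -> R) i p :
  mpair (expser xi) (mX R i * p) = xi i * mpair (expser xi) p.
Proof.
elim: n xi i p => [|n IHn] xi i p; first by case: i.
pose N := size (p : {poly mpoly R n}).
case: (unliftP ord0 i) => [j|] ->.
  rewrite mX_lift !(@mpair_expser_cons _ _ _ N) //; last first.
    by rewrite mul_polyC size_scale_leq.
  rewrite mulr_sumr; apply: eq_bigr => k _.
  by rewrite coefCM IHn mulrCA.
rewrite mX0 (@mpair_expser_cons _ _ _ N.+1); last first.
  by rewrite mulrC (leq_trans (size_polyMleq _ _)) // size_polyX addn2.
rewrite (@mpair_expser_cons _ _ p N) // big_ord_recl coefXM mpair0 mulr0 add0r.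
rewrite mulr_sumr; apply: eq_bigr => k _.
by rewrite coefXM /= exprS mulrA.
Qed.

Lemma mpair_expserM n (xi : 'I_n -> R) :
  {morph mpair (expser xi) : p q / p * q}.
Proof.
move=> p q; elim/mpoly_ind: p => [c|p1 p2 IH1 IH2|i p IHp].
- by rewrite mpairZ mpair_expserC.
- by rewrite mulrDl !mpairD IH1 IH2 mulrDl.
- by rewrite -mulrA !mpair_expserX IHp mulrA.
Qed.

(** [hankel_rank] tests relations coefficientwise, that is, on monomials; since these span, the
    relations hold against every q. *)
Lemma mstar_relation n (s : series R n) r (b : 'I_r -> mpoly R n) c p :
  (forall a, mstar s p a = \sum_(i < r) c i * mstar s (b i) a) <->
  (forall q, mpair s (p * q) = \sum_(i < r) c i * mpair s (b i * q)).
Proof.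
split=> [eq_mono q | eq_all a]; last first.
  by rewrite /mstar eq_all mulr_suml; apply: eq_bigr => i _; rewrite mulrA.
elim/mpoly_ind_mmono: q => [d a|q1 q2 IH1 IH2].
  rewrite mulrCA mpairZ; have := eq_mono a; rewrite /mstar.
  move/(congr1 ( *%R^~ (mfact R a))); rewrite divfK ?mfact_neq0 // => ->.
  rewrite mulr_suml mulr_sumr; apply: eq_bigr => i _.
  by rewrite (mulrCA (b i)) mpairZ -[_ * _ * mfact R a]mulrA divfK ?mfact_neq0 // mulrCA.
rewrite mulrDr mpairD IH1 IH2 -big_split; apply: eq_bigr => i _.
by rewrite mulrDr mpairD mulrDr.
Qed.

End Evaluation.

Definition posdef (R : realFieldType) r (G : 'M[R]_r) :=
  forall c : 'rV_r, c != 0 -> 0 < (c *m G *m c^T) 0 0.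

(** * Matrices self-adjoint for a positive definite form *)

Section PositiveForms.
Variables (R : realFieldType) (r : nat) (G : 'M[R]_r).

Lemma rowvec_sqr_eq0 (v : 'rV[R]_r) : ((v *m v^T) 0 0 == 0) = (v == 0).
Proof.
rewrite mxE (eq_bigr (fun j => v 0 j ^+ 2)); last first.
  by move=> j _; rewrite mxE expr2.
rewrite psumr_eq0 => [|j _]; last exact: sqr_ge0.
apply/allP/eqP => [v0|-> j _]; last by rewrite /= mxE expr0n eqxx.
apply/rowP => j; rewrite mxE; apply/eqP; rewrite -sqrf_eq0.
exact: v0 (mem_index_enum j).
Qed.

(* If c G c^T = 0, then 0 <= (t c + y) G (t c + y)^T = 2 t y y^T + y G y^T for
   y = c G and all t, whence y = 0. *)
Lemma psd_unit_posdef : G^T = G ->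
  G \in unitmx -> (forall c : 'rV_r, 0 <= (c *m G *m c^T) 0 0) -> posdef G.
Proof.
move=> symG uG psdG c nz_c; rewrite lt_def psdG andbT; apply: contraNneq nz_c => cGc.
set y := c *m G; suff /eqP y0 : y == 0 by rewrite -[c](mulmxK uG) -/y y0 mul0mx.
rewrite -rowvec_sqr_eq0; set S := _ 0 0; set q := (y *m G *m y^T) 0 0.
have S_ge0 : 0 <= S.
  by rewrite /S mxE sumr_ge0 // => j _; rewrite [y^T _ _]mxE -expr2 sqr_ge0.
have Gyc : (y *m G *m c^T) 0 0 = S by rewrite -mulmxA -{1}symG -trmx_mul.
have poly_ge0 t : 0 <= t * S *+ 2 + q.
  have := psdG (t *: c + y); congr (_ <= _).
  rewrite mulmxDl -scalemxAl linearD linearZ /= mulmxDr !mulmxDl -!scalemxAr.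
  rewrite -!scalemxAl -/y.
  move: cGc Gyc; rewrite -/y /S /q; set A := (y *m c^T); set B := y *m G *m c^T.
  set C := y *m y^T; set D := y *m G *m y^T => A0 B0.
  by clearbody A B C D; rewrite !mxE A0 B0; ring.
rewrite eq_le S_ge0 andbT leNgt; apply/negP => S_gt0.
(* For this t the expression equals - q - 2, while q >= 0. *)
have := poly_ge0 (- (q + 1) / S).
by rewrite divfK ?gt_eqF //; have := psdG y; rewrite -/q; lra.
Qed.

Hypothesis posG : posdef G.

Lemma posdef_eq0 (c : 'rV_r) : (c *m G *m c^T) 0 0 = 0 -> c = 0.
Proof.
by move=> cGc; apply/eqP; apply: contra_eqT cGc => /posG /gt_eqF ->.
Qed.

(* For self-adjoint A, A^2 = 0 implies (v A) G (v A)^T = v A^2 G v^T = 0; descend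
   along the exponents 2 ^ m. *)
Lemma selfadjoint_nilpotent (N : 'M_r) k :
  N *m G = G *m N^T -> N ^+ k = 0 -> N = 0.
Proof.
move=> adjN; have sqr0 (A : 'M_r) : A *m G = G *m A^T -> A *m A = 0 -> A = 0.
  move=> adjA A2; apply/row_matrixP => i; rewrite row0; apply: posdef_eq0.
  rewrite rowE trmx_mul -!mulmxA (mulmxA G) -adjA !mulmxA.
  by rewrite -(mulmxA _ A A) A2 mulmx0 !mul0mx mxE.
have adj_exp m : N ^+ m *m G = G *m (N ^+ m)^T.
  elim: m => [|m IHm]; first by rewrite expr0 trmx1 mul1mx mulmx1.
  by rewrite {1}exprS exprSr -!mulmxE -mulmxA IHm mulmxA adjN -mulmxA -trmx_mul.
have: forall m, (k <= 2 ^ m)%N -> N ^+ k = 0 -> N = 0.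
  move=> m lekm Nk0; have : N ^+ (2 ^ m) = 0.
    by rewrite -(subnK lekm) exprD Nk0 mulr0.
  elim: m {lekm} => [|m IHm] //; rewrite expnS mulnC exprM expr2 => N2.
  by apply: IHm; apply: sqr0 N2; apply: adj_exp.
by apply; apply: ltnW; apply: ltn_expl.
Qed.

End PositiveForms.

(** * Diagonalization of self-adjoint matrices over a real closed field *)

Section Spectral.
Variable R : rcfType.
Local Notation C := (complex R).
Local Notation toC := (real_complex R).

(** Split an eigenvector as x + iy and put z = s + it. Then x M = s x - t y and y M = t x + s y, and
    (x M) G y^T = x G (y M)^T becomes t (x G x^T + y G y^T) = 0. The bracket vanishes only for x = y
    = 0. *)
Lemma selfadjoint_eigenvalue_real r (G M : 'M[R]_r) (z : C) :
  G^T = G -> posdef G -> M *m G = G *m M^T ->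
  eigenvalue (map_mx toC M) z -> complex.Im z = 0.
Proof.
move=> symG posG adjM /eigenvalueP [v /rowP eq_v nz_v].
pose x := \row_j complex.Re (v 0 j); pose y := \row_j complex.Im (v 0 j).
have eqx : x *m M = complex.Re z *: x - complex.Im z *: y.
  apply/rowP => j; have /(congr1 (@complex.Re R)) := eq_v j.
  rewrite !mxE raddf_sum /= => eq_j; transitivity (complex.Re (z * v 0 j)).
    rewrite -eq_j; apply: eq_bigr => k _; rewrite !mxE.
    by case: (v 0 k) => a b /=; rewrite mulr0 subr0.
  by case: (z) (v 0 j) => a b [c d].
have eqy : y *m M = complex.Im z *: x + complex.Re z *: y.
  apply/rowP => j; have /(congr1 (@complex.Im R)) := eq_v j.
  rewrite !mxE raddf_sum /= => eq_j; transitivity (complex.Im (z * v 0 j)).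
    rewrite -eq_j; apply: eq_bigr => k _; rewrite !mxE.
    by case: (v 0 k) => a b /=; rewrite mulr0 add0r.
  by case: (z) (v 0 j) => a b [c d] /=; rewrite addrC.
have : x *m M *m G *m y^T = x *m G *m (y *m M)^T.
  by rewrite trmx_mul -(mulmxA x M) adjM !mulmxA.
have trD : (complex.Im z *: x + complex.Re z *: y)^T =
    complex.Im z *: x^T + complex.Re z *: y^T by rewrite linearD !linearZ.
rewrite eqx eqy trD mulmxDr !mulmxBl -!scalemxAl -!scalemxAr.
move/(congr1 (fun A : 'M_1 => A 0 0)).
have pos_ge0 (c : 'rV_r) : 0 <= (c *m G *m c^T) 0 0.
  by have [->|/posG /ltW //] := eqVneq c 0; rewrite !mul0mx mxE.
have := (@posdef_eq0 _ _ _ posG x, @posdef_eq0 _ _ _ posG y, pos_ge0 x, pos_ge0 y).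
set xx := x *m G *m x^T; set yy := y *m G *m y^T; set xy := x *m G *m y^T.
clearbody xx yy xy; rewrite !mxE => -[[[x0 y0] xx_ge0] yy_ge0] eq_z.
have /eqP : complex.Im z * (xx 0 0 + yy 0 0) = 0 by lra.
rewrite mulf_eq0 paddr_eq0 // => /orP[/eqP //|/andP[/eqP/x0 x_0 /eqP/y0 y_0]].
case/negP: nz_v; apply/eqP/rowP => j; rewrite mxE.
move/rowP/(_ j): x_0; move/rowP/(_ j): y_0; rewrite !mxE.
by case: (v 0 j) => a b /= -> ->.
Qed.

(** The polynomial splits over the algebraically closed [complex R]; all roots being real, the
    factorization descends to R. *)
Lemma split_real_poly (p : {poly R}) : p \is monic ->
  (forall z : C, root (map_poly toC p) z -> complex.Im z = 0) ->
  exists s : seq R, p = \prod_(x <- s) ('X - x%:P).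
Proof.
move=> mon_p real_p; have [s def_p] := closed_field_poly_normal (map_poly toC p).
exists (map (@complex.Re R) s); apply: (map_poly_inj toC).
rewrite rmorph_prod /= big_map def_p lead_coef_map (monicP mon_p) rmorph1 scale1r.
apply: eq_big_seq => z zs; rewrite rmorphB /= map_polyX map_polyC /=.
have : complex.Im z = 0.
  apply: real_p; rewrite def_p lead_coef_map (monicP mon_p) rmorph1 scale1r.
  by rewrite root_prod_XsubC.
by case: z {zs} => a b /= ->.
Qed.

Lemma dvdp_undup_exp (s : seq R) :
  \prod_(x <- s) ('X - x%:P) %| (\prod_(x <- undup s) ('X - x%:P)) ^+ size s.
Proof.
set q := \prod_(x <- undup s) _.
have: {subset s <= undup s} by move=> x; rewrite mem_undup.
elim: {1 3 4}s => [|x t IHt] st; first by rewrite big_nil dvd1p.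
rewrite big_cons exprS dvdp_mul ?IHt // => [|y yt]; last by rewrite st // inE yt orbT.
by rewrite dvdp_XsubCl root_prod_XsubC st ?mem_head.
Qed.

(* The minimal polynomial splits with roots s; the product q of the distinct factors
   satisfies q(M)^(size s) = 0, so q(M) = 0. *)
Lemma selfadjoint_diagonalizable r (G M : 'M[R]_r) :
  G^T = G -> posdef G -> M *m G = G *m M^T ->
  exists2 P, P \in unitmx & diagonalizable_for P M.
Proof.
case: r G M => [|r] G M symG posG adjM.
  by rewrite (thinmx0 M); apply: diagonalizable0.
apply/diagonalizableP.
have [s def_p] : exists s : seq R, mxminpoly M = \prod_(x <- s) ('X - x%:P).
  apply: split_real_poly (mxminpoly_monic M) _ => z.
  rewrite -mxminpoly_map -eigenvalue_root_min.
  exact: selfadjoint_eigenvalue_real adjM.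
exists (undup s); rewrite ?undup_uniq //; apply: mxminpoly_min.
set q := \prod_(x <- _) _.
have adj_horner p : horner_mx M p *m G = G *m (horner_mx M p)^T.
  elim/poly_ind: p => [|p c IHp]; first by rewrite rmorph0 trmx0 mul0mx mulmx0.
  rewrite rmorphD rmorphM /= horner_mx_X horner_mx_C -mulmxE linearD /=.
  rewrite mulmxDl mulmxDr tr_scalar_mx scalar_mxC; congr (_ + _).
  rewrite trmx_mul -mulmxA adjM mulmxA IHp -!mulmxA -!trmx_mul.
  by congr (_ *m _^T); apply: comm_mx_horner.
apply: (selfadjoint_nilpotent posG (adj_horner q) (k := size s)).
rewrite -rmorphXn; apply/mxminpoly_minP.
by rewrite def_p dvdp_undup_exp.
Qed.

End Spectral.

(** * Flat extension *)

(** In a space of dimension r, any r independent functionals span: the matrix that expresses them in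
    the given basis [q] has trivial kernel, hence is invertible. *)
Lemma has_rank_basis (R : fieldType) (X Y : Type) (D : X -> Prop) (T : Y -> Prop)
    (f : X -> Y -> R) r (b : 'I_r -> X) :
  has_rank D T f r -> (forall i, D (b i)) ->
  (forall c : 'I_r -> R,
     (forall y, T y -> \sum_(i < r) c i * f (b i) y = 0) -> forall i, c i = 0) ->
  forall p, D p -> exists c : 'rV_r,
     forall y, T y -> f p y = \sum_(i < r) c 0 i * f (b i) y.
Proof.
move=> [q [_ [_ span_q]]] Db free_b p Dp.
have /fin_all_exists [A AP] i := span_q _ (Db i).
pose M := \matrix_(i, j) A i j.
have comb (c : 'rV_r) y : T y ->
    \sum_(i < r) c 0 i * f (b i) y = \sum_(j < r) (c *m M) 0 j * f (q j) y.
  move=> Ty; under eq_bigr do rewrite AP // mulr_sumr.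
  rewrite exchange_big; apply: eq_bigr => j _; rewrite mxE mulr_suml.
  by apply: eq_bigr => i _; rewrite mxE mulrA.
have uM : M \in unitmx.
  rewrite -row_free_unit; apply: inj_row_free => c cM0.
  apply/rowP => i; rewrite [RHS]mxE; apply: (free_b (fun i => c 0 i)) => y Ty.
  by rewrite comb // cM0 big1 // => j _; rewrite mxE mul0r.
have [d dP] := span_q _ Dp; exists ((\row_j d j) *m invmx M) => y Ty.
by rewrite comb // mulmxKV // dP //; apply: eq_bigr => j _; rewrite mxE.
Qed.

(** * Linearity of sigma on the span of products *)

Section ProductSpan.
Variables (R : fieldType) (n : nat) (V : mpoly R n -> Prop).
Variable sigma : mpoly R n -> R.
Hypotheses (subV : subspace V) (lin_sigma : linear_on (prodspan V) sigma).

Lemma subspaceZ c p : V p -> V (mC n c * p).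
Proof. by move=> Vp; rewrite -[_ * _]addr0; apply: subV.2 => //; apply: subV.1. Qed.

Lemma subspaceD p q : V p -> V q -> V (p + q).
Proof. by move=> Vp Vq; rewrite -[p]mul1r -(mC1 R n); apply: subV.2. Qed.

Lemma subspace_sum (I : Type) (l : seq I) (f : I -> mpoly R n) :
  (forall i, V (f i)) -> V (\sum_(i <- l) f i).
Proof. by move=> Vf; apply: (big_ind V subV.1 subspaceD). Qed.

Lemma prodspanM p q : V p -> V q -> prodspan V (p * q).
Proof.
by move=> Vp Vq; exists 1, (fun=> p), (fun=> q); rewrite big_ord1.
Qed.

Lemma prodspan0 : prodspan V 0.
Proof. by rewrite -(mul0r 0); apply: prodspanM; apply: subV.1. Qed.

Lemma prodspanD p q : prodspan V p -> prodspan V q -> prodspan V (p + q).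
Proof.
move=> [k [a [b [Vab ->]]]] [l [c [d [Vcd ->]]]].
exists (k + l)%N, (fun i => match split i with inl j => a j | inr j => c j end),
  (fun i => match split i with inl j => b j | inr j => d j end); split.
  by move=> i; case: (split i).
rewrite big_split_ord; congr (_ + _); apply: eq_bigr => i _.
  by rewrite -[lshift l i]/(unsplit (inl i)) unsplitK.
by rewrite -[rshift k i]/(unsplit (inr i)) unsplitK.
Qed.

Lemma linear_on0 : sigma 0 = 0.
Proof.
have := lin_sigma 1 prodspan0 prodspan0; rewrite mulr0 addr0 mul1r.
by move/esym/eqP; rewrite -subr_eq0 addrK => /eqP.
Qed.

Lemma linear_onD p q :
  prodspan V p -> prodspan V q -> sigma (p + q) = sigma p + sigma q.
Proof. by move=> Wp Wq; have := lin_sigma 1 Wp Wq; rewrite mC1 !mul1r. Qed.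

Lemma linear_onZ c p : prodspan V p -> sigma (mC n c * p) = c * sigma p.
Proof.
by move=> Wp; have := lin_sigma c Wp prodspan0; rewrite linear_on0 !addr0.
Qed.

Lemma linear_on_sum (I : Type) (l : seq I) (f : I -> mpoly R n) :
  (forall i, prodspan V (f i)) ->
  sigma (\sum_(i <- l) f i) = \sum_(i <- l) sigma (f i).
Proof.
move=> Wf; elim: l => [|i l IHl]; first by rewrite !big_nil linear_on0.
rewrite !big_cons linear_onD ?IHl //.
by apply: (big_ind (prodspan V) prodspan0 prodspanD).
Qed.

End ProductSpan.

(** * Gram and multiplication matrices modulo the kernel of H^{V,V} *)

Section FlatExtension.
Variables (R : rcfType) (n : nat) (V U : mpoly R n -> Prop).
Variables (sigma : mpoly R n -> R) (r : nat) (b : 'I_r -> mpoly R n).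
Hypotheses (subV : subspace V) (connV : connected_to_1 V).
Hypotheses (lin_sigma : linear_on (prodspan V) sigma).
Hypotheses (subU : subspace U) (UV : forall p, U p -> V p) (U1 : U 1).
Hypothesis UplusV : forall p, vplus U p -> V p.
Hypothesis rankV : sub_hankel_rank sigma V r.
Hypothesis psd_sigma : forall p, V p -> 0 <= sigma (p * p).
Hypothesis Ub : forall i, U (b i).
Hypothesis free_b : forall c : 'I_r -> R,
  (forall y, U y -> \sum_(i < r) c i * sigma (b i * y) = 0) -> forall i, c i = 0.
Hypothesis span_b : forall p, U p -> exists c : 'I_r -> R,
  forall y, U y -> sigma (p * y) = \sum_(i < r) c i * sigma (b i * y).

Let Vb i : V (b i) := UV (Ub i).
Let VXU i p : U p -> V (mX R i * p).
Proof.
move=> Up; apply: UplusV; exists 0, (fun j => if j == i then p else 0).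
split; [exact: subU.1|split=> [j|]]; first by case: eqP => // _; exact: subU.1.
rewrite add0r (bigD1 i) //= eqxx big1 ?addr0 // => j /negPf ->.
by rewrite mulr0.
Qed.

Definition moments w : 'cV[R]_r := \col_m sigma (b m * w).
Definition gram : 'M[R]_r := \matrix_(k, l) sigma (b k * b l).
(** For v in V, the coordinates of its class modulo ker H^{V,V} in the basis of the b_k, found by
    solving the Gram system. *)
Definition coords v : 'rV[R]_r := (\row_m sigma (v * b m)) *m invmx gram.
Definition mulmat i : 'M[R]_r := \matrix_k coords (mX R i * b k).

Lemma gram_sym : gram^T = gram.
Proof. by apply/matrixP => k l; rewrite !mxE mulrC. Qed.

(** If v G = 0, the form of sum_k v_k b_k vanishes on every b_j. By [span_b] and symmetry it then
    vanishes on all of U, so v = 0 by [free_b]. *)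
Lemma gram_unit : gram \in unitmx.
Proof.
rewrite -row_free_unit; apply: inj_row_free => v vG0.
apply/rowP => i; rewrite [RHS]mxE; apply: (free_b (c := fun i => v 0 i)) => y Uy.
have [d dP] := span_b Uy.
transitivity (\sum_(k < r) \sum_(j < r) d j * (v 0 k * gram k j)).
  apply: eq_bigr => k _; rewrite mulrC [b k * y]mulrC dP // mulr_suml.
  by apply: eq_bigr => j _; rewrite mxE (mulrC (b k)) -mulrA (mulrC (sigma _)).
rewrite exchange_big big1 // => j _; rewrite -mulr_sumr.
by have /rowP/(_ j) := vG0; rewrite !mxE => ->; rewrite mulr0.
Qed.

Lemma coords_unique v (c : 'rV_r) :
  (forall m, sigma (v * b m) = (c *m gram) 0 m) -> coords v = c.
Proof.
move=> vc; rewrite /coords (_ : \row_m _ = c *m gram) ?mulmxK ?gram_unit //.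
by apply/rowP => m; rewrite mxE vc.
Qed.

(** Equality of the ranks enters here: the b_k, independent on U and hence on V, span the image of
    H^{V,V}. *)
Lemma coordsP v w : V v -> V w -> sigma (v * w) = (coords v *m moments w) 0 0.
Proof.
move=> Vv Vw; have [|c cP] := has_rank_basis rankV Vb _ Vv.
  move=> c c0; apply: free_b => y Uy; apply: c0; exact: UV.
rewrite cP // (@coords_unique v c) => [|m].
  by rewrite mxE; apply: eq_bigr => i _; rewrite mxE.
by rewrite cP // mxE; apply: eq_bigr => i _; rewrite mxE.
Qed.

Lemma moments_coords w : V w -> moments w = gram *m (coords w)^T.
Proof.
move=> Vw; apply/colP => m; rewrite mxE mulrC coordsP // -[gram]trmxK -trmx_mul.
rewrite gram_sym [RHS]mxE [RHS]mxE [LHS]mxE; apply: eq_bigr => k _.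
by congr (_ * _); rewrite !mxE.
Qed.

Lemma coords_basis j : coords (b j) = delta_mx 0 j.
Proof. by apply: coords_unique => m; rewrite -rowE !mxE. Qed.

Lemma mulmatP i k w : V w -> sigma (mX R i * b k * w) = (mulmat i *m moments w) k 0.
Proof.
move=> Vw; rewrite coordsP //; last exact: VXU.
by rewrite !mxE; apply: eq_bigr => l _; rewrite !mxE.
Qed.

Lemma mulmat_gram i k m : (mulmat i *m gram) k m = sigma (mX R i * b k * b m).
Proof.
rewrite mulmatP // !mxE; apply: eq_bigr => l _; rewrite !mxE //.
Qed.

Lemma mulmat_gram_sym i : mulmat i *m gram = gram *m (mulmat i)^T.
Proof.
rewrite -[in RHS]gram_sym -trmx_mul; apply/matrixP => k m.
by rewrite mulmat_gram mxE mulmat_gram mulrAC.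
Qed.

(** The entries of M_i M_j G are sigma(x_i b_k x_j b_m), symmetric in i and j. Each variable is
    attached to its own factor, so that both factors stay in V. *)
Lemma mulmat_comm i j : mulmat i *m mulmat j = mulmat j *m mulmat i.
Proof.
have entry i1 i2 k m : (mulmat i1 *m mulmat i2 *m gram) k m =
    sigma (mX R i1 * b k * (mX R i2 * b m)).
  rewrite mulmatP; last exact: VXU.
  rewrite -mulmxA !mxE; apply: eq_bigr => l _; congr (_ * _).
  by rewrite mulmat_gram mxE; congr sigma; rewrite mulrCA mulrA.
apply: (can_inj (mulmxK gram_unit)); apply/matrixP => k m.
by rewrite !entry; congr sigma; rewrite mulrACA (mulrC (mX R i)) mulrACA.
Qed.

(** For p = sum_k c_k b_k one has c G c^T = sigma(p^2) >= 0, and G is invertible. *)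
Lemma gram_posdef : posdef gram.
Proof.
apply: psd_unit_posdef gram_sym gram_unit _ => c.
pose p := \sum_(k < r) mC n (c 0 k) * b k.
have Vp : V p by apply: subspace_sum => // k; apply: subspaceZ.
have sigma_pw w : V w -> sigma (p * w) = (c *m moments w) 0 0.
  move=> Vw; rewrite /p mulr_suml (linear_on_sum subV lin_sigma); last first.
    by move=> k; apply: prodspanM => //; apply: subspaceZ.
  rewrite mxE; apply: eq_bigr => k _; rewrite -mulrA mxE.
  by rewrite (linear_onZ subV lin_sigma) //; apply: prodspanM.
have -> : (c *m gram *m c^T) 0 0 = sigma (p * p); last exact: psd_sigma.
rewrite sigma_pw // moments_coords // mulmxA; congr ((_ *m _^T) 0 0).
symmetry; apply: coords_unique => m; rewrite sigma_pw // !mxE.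
by apply: eq_bigr => k _; rewrite !mxE.
Qed.

Lemma mulmat_codiagonalizable : exists (P : 'M_r) (D : 'I_n -> 'rV_r),
  P \in unitmx /\ forall i, P *m mulmat i = diag_mx (D i) *m P.
Proof.
have [|P uP /allP /= diagP] := (codiagonalizableP [seq mulmat i | i <- enum 'I_n]).1.
  split=> [_ _ /mapP[i _ ->] /mapP[j _ ->]|_ /mapP[i _ ->]].
    exact: mulmat_comm.
  exact: selfadjoint_diagonalizable gram_sym gram_posdef (mulmat_gram_sym i).
have /fin_all_exists [D DP] i : exists d, P *m mulmat i = diag_mx d *m P.
  have /diagonalizable_forPex [d /(simmxP uP)] :=
    diagP _ (map_f mulmat (mem_enum 'I_n i)).
  by exists d.
by exists P, D.
Qed.

(** * Nodes, weights and the quadrature series *)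

Section Diagonal.
Variables (P : 'M[R]_r) (D : 'I_n -> 'rV[R]_r).
Hypotheses (uP : P \in unitmx) (PD : forall i, P *m mulmat i = diag_mx (D i) *m P).

(* xi_k, a_k and (for k = l) delta_k: node k, coef1 0 k and diagform k l. *)
Definition node k : 'I_n -> R := fun i => D i 0 k.
Local Notation eval k := (mpair (expser (node k))).
Definition coef1 : 'rV[R]_r := coords 1 *m invmx P.
Definition diagform : 'M[R]_r := P *m gram *m P^T.
Definition weight k := diagform k k * coef1 0 k ^+ 2.

Let mulmat_diag i : mulmat i *m invmx P = invmx P *m diag_mx (D i).
Proof. by apply: (can_inj (mulKmx uP)); rewrite mulmxA PD mulmxK // mulKVmx. Qed.

(** Induction along the chain that connects V to 1: a factor x_i acts on coordinates by M_i, which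
    becomes D_i in the eigenbasis, that is, multiplication by the i-th coordinate of xi_k. *)
Lemma coords_eval v k : V v ->
  (coords v *m invmx P) 0 k = eval k v * coef1 0 k.
Proof.
have [s [W [subW [W0 [chainW Ws]]]]] := connV.
have WV l p : (l <= s)%N -> W l p -> V p.
  move=> les; rewrite -(subKn les) => Wp; apply/Ws; move: Wp.
  elim: (s - l)%N (leq_subr l s) => [|m IHm] lem; first by rewrite subn0.
  move=> Wp; apply: IHm; first exact: ltnW.
  by rewrite -subnSK //; apply: (chainW _ _).1 => //;
     rewrite ltn_subrL /= (leq_trans _ lem).
suff main l p : (l <= s)%N -> W l p ->
    (coords p *m invmx P) 0 k = eval k p * coef1 0 k.
  by move=> /Ws; apply: main.
elim: l p => [|l IHl] p les Wp.
  have [c ->] := (W0 p).1 Wp; rewrite mpair_expserC (_ : coords _ = c *: coords 1).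
    by rewrite -scalemxAl mxE.
  apply: coords_unique => m; rewrite -scalemxAl mxE (linear_onZ subV lin_sigma).
    by rewrite /coords mulmxKV ?gram_unit // mxE mul1r.
  by rewrite -[b m]mul1r; apply: prodspanM => //; apply: UV.
have [q0 [q [Wq0 [Wq def_p]]]] := (chainW l les).2 p Wp.
have lels := ltnW les; have Vq0 := WV _ _ lels Wq0.
have Vq i : V (q i) := WV _ _ lels (Wq i).
(* The single terms x_i q_i need not lie in V; the variable is moved onto b_m, since x_i b_m is in
   V. *)
have -> : coords p = coords q0 + \sum_(i < n) coords (q i) *m mulmat i.
  apply: coords_unique => m; rewrite mulmxDl mxE mulmx_suml summxE def_p mulrDl.
  have WXq i : prodspan V (mX R i * q i * b m).
    by rewrite mulrAC mulrC; apply: prodspanM => //; apply: VXU.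
  rewrite mulr_suml (linear_onD lin_sigma) ?(linear_on_sum subV lin_sigma) //; last first.
  - exact: (big_ind (prodspan V) (prodspan0 subV) (@prodspanD _ _ V)).
  - exact: prodspanM.
  congr (_ + _); first by rewrite /coords mulmxKV ?gram_unit // mxE.
  apply: eq_bigr => i _; rewrite mulrAC mulrC coordsP //; last exact: VXU.
  rewrite -mulmxA [LHS]mxE [RHS]mxE; apply: eq_bigr => l' _.
  by rewrite mulmat_gram [moments _ _ _]mxE; congr (_ * sigma _); rewrite mulrCA mulrA.
rewrite def_p mpairD mpair_sum mulmxDl mxE IHl // mulrDl; congr (_ + _).
rewrite mulmx_suml summxE mulr_suml; apply: eq_bigr => i _.
rewrite mpair_expserX -mulmxA mulmat_diag mulmxA mul_mx_diag mxE IHl //.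
by rewrite mulrC mulrA.
Qed.

Lemma inv_eval j k : invmx P j k = eval k (b j) * coef1 0 k.
Proof. by rewrite -coords_eval // coords_basis -rowE mxE. Qed.

(** Up to the factors a_l, the polynomials sum_j P_kj b_j are Lagrange interpolators at the nodes.
    This forces a_k to be nonzero and the nodes to be distinct. *)
Let dual_eval k l :
  coef1 0 l * \sum_(j < r) P k j * eval l (b j) = (k == l)%:R.
Proof.
have <- : (P *m invmx P) k l = (k == l)%:R by rewrite mulmxV // mxE.
by rewrite [RHS]mxE mulr_sumr; apply: eq_bigr => j _; rewrite inv_eval; ring.
Qed.

Lemma coef1_neq0 k : coef1 0 k != 0.
Proof.
apply/eqP => a0; have /eqP := dual_eval k k.
by rewrite a0 mul0r eqxx eq_sym oner_eq0.
Qed.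

Lemma node_inj k l : node k =1 node l -> k = l.
Proof.
move=> eq_kl; apply/eqP; rewrite -[_ == _]negbK; apply/negP => /negPf neq_kl.
have eq_eval p : eval l p = eval k p.
  by apply: eq_mpair => a; apply: eq_bigr => i _; rewrite eq_kl.
have /eqP := dual_eval k l; rewrite neq_kl mulf_eq0 (negPf (coef1_neq0 l)) /=.
under eq_bigr do rewrite eq_eval; move=> /eqP sum0.
by have /eqP := dual_eval k k; rewrite sum0 mulr0 eqxx eq_sym oner_eq0.
Qed.

(** Self-adjointness of M_i makes D_i commute with P G P^T. A nonzero entry at (k, l) would
    therefore give xi_k = xi_l. *)
Lemma diagform_diag k l : k != l -> diagform k l = 0.
Proof.
move=> neq_kl; have symQ m p : diagform m p = diagform p m.
  by rewrite -[in LHS](trmxK diagform) mxE /diagform !trmx_mul trmxK gram_sym mulmxA.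
apply/eqP; apply: contra_neqT neq_kl => Q_neq0; apply: node_inj => i.
apply: (mulIf Q_neq0); rewrite /node.
have : diag_mx (D i) *m diagform = diagform *m diag_mx (D i).
  rewrite /diagform mulmxA mulmxA -PD -(mulmxA P) mulmat_gram_sym.
  rewrite mulmxA -!mulmxA; congr (_ *m (_ *m _)).
  by rewrite -trmx_mul PD trmx_mul tr_diag_mx.
move/matrixP/(_ k l); rewrite mul_diag_mx mul_mx_diag !mxE => ->.
by rewrite mulrC.
Qed.

Lemma weight_gt0 k : 0 < weight k.
Proof.
rewrite mulr_gt0 ?exprn_even_gt0 ?coef1_neq0 //.
have -> : diagform k k = (row k P *m gram *m (row k P)^T) 0 0.
  rewrite tr_row -row_mul [RHS]mxE [LHS]mxE; apply: eq_bigr => j _.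
  by rewrite [row _ _ _ _]mxE [col _ _ _ _]mxE.
apply: gram_posdef; apply/eqP => row0P.
have /rowP/(_ k) : row k (P *m invmx P) = 0 by rewrite row_mul row0P mul0mx.
by rewrite mulmxV // !mxE eqxx; apply/eqP; rewrite oner_eq0.
Qed.

Let diagformV (c : 'rV_r) : diagform *m (c *m invmx P)^T = P *m gram *m c^T.
Proof. by rewrite /diagform -mulmxA -trmx_mul mulmxKV. Qed.

Lemma moments1 k : (P *m moments 1) k 0 = diagform k k * coef1 0 k.
Proof.
have -> : P *m moments 1 = diagform *m coef1^T.
  rewrite moments_coords; last exact: UV.
  by rewrite diagformV mulmxA.
rewrite mxE (bigD1 k) //= big1 ?addr0 => [|l /negPf neq_lk].
  by rewrite [_^T _ _]mxE.
by rewrite diagform_diag ?mul0r // eq_sym neq_lk.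
Qed.

Definition quadrature : series R n :=
  fun a => \sum_(k < r) weight k * expser (node k) a.

Lemma mpair_quadrature p :
  mpair quadrature p = \sum_(k < r) weight k * eval k p.
Proof. exact: mpair_series_linear. Qed.

(** In the eigenbasis, sigma(v w) is a diagonal form in the coordinates v(xi_k) a_k and w(xi_k)
    a_k. *)
Lemma quadrature_extends p : prodspan V p -> mpair quadrature p = sigma p.
Proof.
move=> [m [v [w [Vvw ->]]]]; rewrite mpair_sum (linear_on_sum subV lin_sigma); last first.
  by move=> i; have [Vv Vw] := Vvw i; apply: prodspanM.
apply: eq_bigr => i _; have [Vv Vw] := Vvw i.
rewrite mpair_quadrature coordsP // moments_coords //.
transitivity ((coords (v i) *m invmx P *m diagform *m (coords (w i) *m invmx P)^T) 0 0).
  rewrite mxE; apply: eq_bigr => k _.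
  rewrite [RHS](_ : _ = (coords (v i) *m invmx P) 0 k * diagform k k *
      (coords (w i) *m invmx P) 0 k).
    rewrite (coords_eval k Vv) (coords_eval k Vw) mpair_expserM.
    rewrite /weight.
    move: (diagform k k) (coef1 0 k) (eval k _) (eval k _) => d a x y.
    by ring.
  rewrite [_^T _ _]mxE; congr (_ * _).
  rewrite mxE (bigD1 k) //= big1 ?addr0 // => l neq_lk.
  by rewrite diagform_diag ?mulr0.
by rewrite -mulmxA diagformV !mulmxA mulmxKV.
Qed.

(** Tested against y in U, a relation among the series b_i star s involves only values of sigma.
    This holds for any extension s, so it serves both existence and uniqueness. *)
Lemma moments_free_on (s : series R n) (c : 'I_r -> R) :
  (forall p, prodspan V p -> mpair s p = sigma p) ->
  (forall a : n.-tuple nat, True -> \sum_(i < r) c i * mstar s (b i) a = 0) ->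
  forall i, c i = 0.
Proof.
move=> ext_s c0; apply: free_b => y Uy.
have /mstar_relation/(_ y) : forall a, mstar s 0 a = \sum_(i < r) c i * mstar s (b i) a.
  by move=> a; rewrite c0 // /mstar mul0r mpair0 mul0r.
rewrite mul0r mpair0 => /esym eq0; rewrite -[RHS]eq0; apply: eq_bigr => i _.
by rewrite ext_s //; apply: prodspanM => //; apply: UV.
Qed.

Lemma quadrature_rank : hankel_rank quadrature r.
Proof.
exists b; split => //; split.
  by move=> c; apply: moments_free_on quadrature_extends.
(* Since b_j(xi_k) a_k is the entry (j, k) of P^-1, the polynomial sum_j (d P)_j b_j agrees with p
   at every node. *)
move=> p _; pose d := \row_k (coef1 0 k * eval k p).
exists (fun j => (d *m P) 0 j) => a _; move: a; apply/mstar_relation => q.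
under [RHS]eq_bigr do rewrite mpair_quadrature mulr_sumr.
rewrite mpair_quadrature exchange_big; apply: eq_bigr => k _ /=.
have -> : \sum_(j < r) (d *m P) 0 j * (weight k * eval k (b j * q)) =
    weight k * eval k q * ((d *m P *m invmx P) 0 k / coef1 0 k).
  rewrite [in RHS]mxE mulr_suml mulr_sumr; apply: eq_bigr => j _.
  rewrite inv_eval mpair_expserM.
  by have := coef1_neq0 k; set a := coef1 0 k => nz_a; field.
rewrite (mulmxK uP) [d _ _]mxE mpair_expserM (mulrC (coef1 0 k)).
by rewrite (mulfK (coef1_neq0 k)) -mulrA [eval k q * _]mulrC.
Qed.

(** * Uniqueness of the extension of rank r *)

Section Uniqueness.
Variable s : series R n.
Hypotheses (ext_s : forall p, prodspan V p -> mpair s p = sigma p).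
Hypothesis rank_s : hankel_rank s r.

Let hankel_moments p : 'cV[R]_r := \col_k mpair s (b k * p).

(** Relations modulo ker H^{V,V} persist against every q: by the rank of s, q star s is a
    combination of the b_i star s, so that s(v q) reduces to the values sigma(b_i v). *)
Lemma hankel_coords v q :
  V v -> mpair s (v * q) = (coords v *m hankel_moments q) 0 0.
Proof.
move=> Vv; have [||d dP] := has_rank_basis rank_s (b := b) _ _ (p := q) I.
- by [].
- by move=> c; apply: moments_free_on.
have {}dP p : mpair s (q * p) = \sum_(i < r) d 0 i * mpair s (b i * p).
  by move: p; apply/mstar_relation => a; apply: dP.
rewrite mulrC dP mxE.
transitivity (\sum_(i < r) \sum_(k < r) coords v 0 k * (d 0 i * gram i k)).
  apply: eq_bigr => i _; rewrite mulrC [b i * v]mulrC ext_s; last exact: prodspanM.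
  rewrite coordsP // mxE mulr_suml; apply: eq_bigr => k _.
  by rewrite [moments _ _ _]mxE [gram _ _]mxE (mulrC (b i)); ring.
rewrite exchange_big; apply: eq_bigr => k _; rewrite -mulr_sumr; congr (_ * _).
rewrite [RHS]mxE mulrC dP; apply: eq_bigr => i _.
by rewrite [gram _ _]mxE ext_s //; apply: prodspanM.
Qed.

(** The recursion for x_i p has matrix M_i; applying P decouples it into scalar recursions with
    factors the coordinates of xi_k. *)
Lemma hankel_moments_eval k p :
  (P *m hankel_moments p) k 0 = eval k p * (P *m moments 1) k 0.
Proof.
elim/mpoly_ind: p => [c|p q IHp IHq|i p IHp].
- rewrite mpair_expserC (_ : hankel_moments _ = c *: moments 1).
    by rewrite -scalemxAr mxE.
  apply/colP => j; rewrite !mxE mulrC mpairZ -[in LHS](mulr1 (b j)) ext_s //.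
  by apply: prodspanM => //; apply: UV.
- rewrite (_ : hankel_moments _ = hankel_moments p + hankel_moments q).
    by rewrite mulmxDr mxE IHp IHq mpairD mulrDl.
  by apply/colP => j; rewrite !mxE mulrDr mpairD.
- rewrite (_ : hankel_moments _ = mulmat i *m hankel_moments p).
    by rewrite mulmxA PD -mulmxA mul_diag_mx mxE IHp mpair_expserX mulrA.
  apply/colP => j; rewrite mxE mulrA (mulrC (b j)) hankel_coords; last exact: VXU.
  by rewrite [LHS]mxE [RHS]mxE; apply: eq_bigr => l _; rewrite [mulmat _ _ _]mxE.
Qed.

Lemma quadrature_unique a : s a = quadrature a.
Proof.
move: a; apply: mpair_inj => p; rewrite mpair_quadrature -[p in LHS]mul1r.
rewrite hankel_coords; last exact: UV.
(* With s(p) = s(1 p), inserting P^-1 P gives sum_k a_k (delta_k a_k p(xi_k)), the quadrature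
   formula. *)
rewrite -[hankel_moments p](mulKmx uP) (mulmxA (coords 1)) -/coef1.
rewrite [LHS]mxE; apply: eq_bigr => k _; rewrite hankel_moments_eval moments1.
rewrite /weight; move: (diagform k k) (coef1 0 k) (eval k p) => d a x.
by ring.
Qed.

End Uniqueness.

End Diagonal.
End FlatExtension.

Theorem theorem4 (R : rcfType) (n : nat) (V U : mpoly R n -> Prop)
    (sigma : mpoly R n -> R) (r : nat) :
  subspace V -> connected_to_1 V ->
  linear_on (prodspan V) sigma ->
  subspace U -> (forall p, U p -> V p) -> U 1 ->
  (forall p, vplus U p -> V p) ->
  sub_hankel_rank sigma V r -> sub_hankel_rank sigma U r ->
  (forall p, V p -> 0 <= sigma (p * p)) ->
  (exists! s : series R n,
     (forall p, prodspan V p -> mpair s p = sigma p) /\ hankel_rank s r) /\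
  (forall s : series R n,
     (forall p, prodspan V p -> mpair s p = sigma p) -> hankel_rank s r ->
     exists (w : 'I_r -> R) (xi : 'I_r -> 'I_n -> R),
       (forall i, 0 < w i) /\
       s = (fun a => \sum_(i < r) w i * expser (xi i) a)).
Proof.
move=> subV connV lin_sigma subU UV U1 UplusV rankV [b [Ub [free_b span_b]]] psd_sigma.
have [P [D [uP PD]]] : exists (P : 'M_r) (D : 'I_n -> 'rV_r),
    P \in unitmx /\ forall i, P *m mulmat sigma b i = diag_mx (D i) *m P.
  exact: (mulmat_codiagonalizable subV lin_sigma subU UV UplusV).
(* Every extension of rank r is the quadrature series; this gives both the uniqueness and the
   required form. *)
have unique s : (forall p, prodspan V p -> mpair s p = sigma p) ->
    hankel_rank s r -> s = quadrature sigma b P D.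
  move=> ext_s rank_s; apply: functional_extensionality => a.
  exact: (quadrature_unique subV connV lin_sigma subU UV).
split=> [|s ext_s rank_s].
  exists (quadrature sigma b P D); split=> [|s [ext_s rank_s]]; last exact/esym/unique.
  split; first exact: (quadrature_extends subV connV lin_sigma subU UV U1 UplusV).
  exact: (quadrature_rank subV connV lin_sigma subU UV U1 UplusV).
exists (weight sigma b P), (node D); split=> [i|]; last exact: unique.
exact: (weight_gt0 subV connV lin_sigma subU UV U1 UplusV).
Qed.
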